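(* Let $F$ be Thompson's group with its standard generators $x_0,x_1$, acting on the set $\mathbb{D}$ of dyadic rationals in $[0,1]$, and let $\mathcal{H}$ be the Schreier graph, with respect to $\{x_0,x_1\}$, of the action of $F$ on the orbit of $1/2$. Then the Poisson boundary of the simple random walk on $\mathcal{H}$ (started at $1/2$) is non-trivial; equivalently, there is a non-constant bounded harmonic function on $\mathcal{H}$.
   Context: Thompson's group $F$ is the group (under composition) of all orientation-preserving piecewise linear homeomorphisms of $[0,1]$ with finitely many points of non-differentiability, all of which are dyadic rationals, and whose derivative, where it exists, is an integer power of $2$. It is generated by $x_0,x_1$, where $x_0(t)=t/2$ for $0\le t\le 1/2$, $x_0(t)=t-1/4$ for $1/2\le t\le 3/4$, $x_0(t)=2t-1$ for $3/4\le t\le 1$; and $x_1(t)=t$ for $0\le t\le 1/2$, $x_1(t)=\tfrac12+\tfrac12 x_0(2t-1)$ for $1/2\le t\le 1$. The Schreier graph $\mathcal{H}$ has as vertices the points of the $F$-orbit of $1/2$ (all dyadic rationals in $(0,1)$), and for each vertex $y$ and each $s\in\{x_0,x_1\}$ an edge joining $y$ and $s(y)$ (loops and multiple edges allowed). The simple random walk on $\mathcal{H}$ moves from $y$ to $x_0(y),x_0^{-1}(y),x_1(y),x_1^{-1}(y)$, each chosen with probability $1/4$ (added up when these points coincide). A function $h$ on the vertices is harmonic if $h(y)=\frac14\sum_{s\in\{x_0^{\pm1},x_1^{\pm1}\}}h(s(y))$ for every $y$. The Poisson boundary of a random walk on vertex set $V$ with a fixed starting point is the space of ergodic components of the time shift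 on $(V^{\mathbb{Z}_+},P)$, where $P$ is the law of the trajectory; it is non-trivial if there is a shift-invariant event of probability strictly between $0$ and $1$. *)

(* Defs.v *)
From HB Require Import structures.
From mathcomp Require Import all_boot all_order all_algebra.
From mathcomp Require Import all_classical all_reals all_analysis.
From mathcomp Require Import ring lra.
Set Implicit Arguments.
Unset Strict Implicit.
Unset Printing Implicit Defensive.
Import Order.TTheory GRing.Theory Num.Theory.
Import numFieldNormedType.Exports.
Local Open Scope classical_set_scope.
Local Open Scope ring_scope.

Section Thompson.
Variable R : realType.
Implicit Types (f : R -> R) (s : seq R) (t u v y z : R).

Definition dyadic t : Prop := exists (k : int) (n : nat), t = k%:~R / 2 ^+ n.

(* [s] contains every breakpoint of [f]: on each subinterval of [0,1] with no
   point of [s] in its interior, [f] is affine with slope a power of 2. *)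
Definition pl_pow2 s f : Prop :=
  forall u v, 0 <= u -> u < v -> v <= 1 ->
    (forall b, b \in s -> ~~ (u < b < v)) ->
  exists k : int, forall t, u <= t <= v -> f t = f u + 2 ^ k * (t - u).

(* An element of F is represented by any function R -> R whose restriction to
   [0,1] is that element; values outside [0,1] are irrelevant. *)
Definition thompsonF : set (R -> R) := [set f : R -> R |
  [/\ set_bij `[0, 1] `[0, 1] f,
      {within `[0, 1], continuous f},
      {in `[0, 1] &, {homo f : u v / u < v}} &
      exists s : seq R, (forall b, b \in s -> dyadic b) /\ pl_pow2 s f]].

Definition x0 t : R :=
  if t <= 1/2 then t / 2 else if t <= 3/4 then t - 1/4 else 2 * t - 1.
Definition x1 t : R := if t <= 1/2 then t else 1/2 + 1/2 * x0 (2 * t - 1).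

Definition x0V t : R :=
  if t <= 1/4 then 2 * t else if t <= 1/2 then t + 1/4 else (t + 1) / 2.
Definition x1V t : R := if t <= 1/2 then t else 1/2 + 1/2 * x0V (2 * t - 1).

Lemma x0K : cancel x0 x0V.
Proof.
move=> t; rewrite /x0 /x0V.
by case: (leP t (1/2)) => ?; [|case: (leP t (3/4)) => ?];
   do 2?[case: leP => ?]; lra.
Qed.

Lemma x0VK : cancel x0V x0.
Proof.
move=> t; rewrite /x0 /x0V.
by case: (leP t (1/4)) => ?; [|case: (leP t (1/2)) => ?];
   do 2?[case: leP => ?]; lra.
Qed.

Lemma x1K : cancel x1 x1V.
Proof.
move=> t; rewrite /x1; case: (leP t (1/2)) => t2.
  by rewrite /x1V t2.
have x0t : 0 < x0 (2 * t - 1).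
  by rewrite /x0; case: (leP _ (1/2)) => ?; [|case: (leP _ (3/4)) => ?]; lra.
rewrite /x1V ifF; last by apply/negbTE; rewrite -ltNge; lra.
rewrite (_ : 2 * _ - 1 = x0 (2 * t - 1)); last by lra.
by rewrite x0K; lra.
Qed.

Lemma x1VK : cancel x1V x1.
Proof.
move=> t; rewrite /x1V; case: (leP t (1/2)) => t2.
  by rewrite /x1 t2.
have x0t : 0 < x0V (2 * t - 1).
  by rewrite /x0V; case: (leP _ (1/4)) => ?; [|case: (leP _ (1/2)) => ?]; lra.
rewrite /x1 ifF; last by apply/negbTE; rewrite -ltNge; lra.
rewrite (_ : 2 * _ - 1 = x0V (2 * t - 1)); last by lra.
by rewrite x0VK; lra.
Qed.

Definition steps : seq (R -> R) := [:: x0; x0V; x1; x1V].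

Definition Forbit y : set R := [set z | exists2 f, thompsonF f & z = f y].

Lemma thompsonF_id : thompsonF id.
Proof.
split.
- by split=> // u u01; exists u.
- by apply: continuous_subspaceT => t; exact: cvg_id.
- by move=> u v.
- exists [::]; split=> // u v _ _ _ _; exists 0 => t _.
  by rewrite expr0z mul1r addrC subrK.
Qed.

(* The vertex set of the Schreier graph H. *)
Definition vertex : Type := set_type (Forbit (1/2)).

Lemma half_Forbit : 1/2 \in Forbit (1/2).
Proof. by rewrite inE; exists id => //; exact: thompsonF_id. Qed.

Definition half_vertex : vertex := exist _ (1/2 : R) half_Forbit.

HB.instance Definition _ := Choice.copy vertex (set_type (Forbit (1/2))).
HB.instance Definition _ := isPointed.Build vertex half_vertex.

(* Steps leading to the same vertex are counted with multiplicity. *)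
Definition srw_H (y z : vertex) : R :=
  (count (fun g : R -> R => g (val y) == val z) steps)%:R / 4.

(* Functions on the vertices of H are represented by functions on R, of which
   only the restriction to the orbit of 1/2 matters. *)
Definition harmonic_H (h : R -> R) : Prop :=
  forall y, Forbit (1/2) y -> h y = 1/4 * \sum_(g <- steps) h (g y).

Definition bounded_H (h : R -> R) : Prop :=
  exists M : R, forall y, Forbit (1/2) y -> `|h y| <= M.

Definition nonconstant_H (h : R -> R) : Prop :=
  exists y z, [/\ Forbit (1/2) y, Forbit (1/2) z & h y <> h z].

End Thompson.

Section PoissonBoundary.
Variables (R : realType) (V : pointedType).

Definition coordinate_events : set (set (nat -> V)) :=
  [set A | exists (n : nat) (B : set V), A = [set w | B (w n)]].

(* V^{Z_+} with the product of the discrete sigma-algebras. *)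
Local Notation trajectory := (g_sigma_algebraType coordinate_events).

Definition shift (w : trajectory) : trajectory := fun n => w n.+1.

(* [P] is the law of the Markov chain with transition probabilities [p] started
   at [o]; for countable [V] these cylinder probabilities determine [P]. *)
Definition trajectory_law (p : V -> V -> R) (o : V)
    (P : probability trajectory R) : Prop :=
  forall (n : nat) (v : nat -> V),
    P [set w | forall i, (i <= n)%N -> w i = v i] =
    ((v 0%N == o)%:R * \prod_(i < n) p (v i) (v i.+1))%:E.

Definition poisson_boundary_nontrivial (p : V -> V -> R) (o : V) : Prop :=
  exists2 P : probability trajectory R, trajectory_law p o P &
  exists A : set trajectory,
    [/\ measurable A, shift @^-1` A = A & (0 < P A < 1)%E].

End PoissonBoundary.

(* Main.v *)
(* Every vertex other than the root 1/2 has a parent, obtained by x0^-1, x1^-1 or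
   x0 according to its position, and the edges to the parents form a spanning
   tree of H.  Except for dead ends, every vertex in [1/2, 3/4) has two children
   and every vertex in [3/4, 7/8) one child carrying flow, so that a unit flow
   entering at 9/16, split evenly at every branching, and its opposite entering
   at 13/16 (both are children of 5/8) give a flow whose potential, the height, is
   harmonic.  The flow decays geometrically along the branches, so the height is
   bounded.

   For the Poisson boundary, realize the walk by the base 4 digits of a uniform
   point of [0,1].  If h is bounded harmonic and h > 0 at a vertex reached at time
   N, then E[h(X_n); h(X_i) > 0 for N <= i <= n] is nondecreasing in n >= N,
   because leaving {h > 0} only discards nonpositive terms of a martingale;
   hence with positive probability h(X_n) > 0 for all n >= N.  Applied to the
   height, positive at 9/16, and to its opposite, positive at 13/16, this gives
   two disjoint shift-invariant events of positive probability. *)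
Require Import Defs.
From HB Require Import structures.
From mathcomp Require Import all_boot all_order all_algebra.
From mathcomp Require Import all_classical all_reals all_analysis.
From mathcomp Require Import ring lra.
Set Implicit Arguments.
Unset Strict Implicit.
Unset Printing Implicit Defensive.
Import Order.TTheory GRing.Theory Num.Theory.
Import numFieldNormedType.Exports.
Local Open Scope classical_set_scope.
Local Open Scope ring_scope.

(** * Affine pieces of the generators and of their inverses *)

Section Generators.
Variable R : realType.
Implicit Types t : R.

Lemma x0_lo t : t <= 1/2 -> x0 t = t / 2.
Proof. by rewrite /x0 => ->. Qed.

Lemma x0_mid t : 1/2 <= t -> t <= 3/4 -> x0 t = t - 1/4.
Proof. by rewrite /x0 => ? ->; case: (leP t (1/2)) => // ?; lra. Qed.

Lemma x0_hi t : 3/4 <= t -> x0 t = 2 * t - 1.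
Proof.
by rewrite /x0 => ?; case: (leP t (1/2)) => ?; [lra|];
  case: (leP t (3/4)) => ?; lra.
Qed.

Lemma x0V_lo t : t <= 1/4 -> x0V t = 2 * t.
Proof. by rewrite /x0V => ->. Qed.

Lemma x0V_mid t : 1/4 <= t -> t <= 1/2 -> x0V t = t + 1/4.
Proof. by rewrite /x0V => ? ->; case: (leP t (1/4)) => // ?; lra. Qed.

Lemma x0V_hi t : 1/2 <= t -> x0V t = (t + 1) / 2.
Proof.
by rewrite /x0V => ?; case: (leP t (1/4)) => ?; [lra|];
  case: (leP t (1/2)) => ?; lra.
Qed.

Lemma x1_id t : t <= 1/2 -> x1 t = t.
Proof. by rewrite /x1 => ->. Qed.

Lemma x1_ge t : 1/2 <= t -> x1 t = 1/2 + 1/2 * x0 (2 * t - 1).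
Proof.
by rewrite /x1 => ?; case: (leP t (1/2)) => // ?; rewrite x0_lo; lra.
Qed.

Lemma x1_lo t : 1/2 <= t -> t <= 3/4 -> x1 t = t / 2 + 1/4.
Proof. by move=> ? ?; rewrite x1_ge// x0_lo; lra. Qed.

Lemma x1_mid t : 3/4 <= t -> t <= 7/8 -> x1 t = t - 1/8.
Proof. by move=> ? ?; rewrite x1_ge ?x0_mid; lra. Qed.

Lemma x1_hi t : 7/8 <= t -> x1 t = 2 * t - 1.
Proof. by move=> ?; rewrite x1_ge ?x0_hi; lra. Qed.

Lemma x1V_id t : t <= 1/2 -> x1V t = t.
Proof. by rewrite /x1V => ->. Qed.

Lemma x1V_ge t : 1/2 <= t -> x1V t = 1/2 + 1/2 * x0V (2 * t - 1).
Proof.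
by rewrite /x1V => ?; case: (leP t (1/2)) => // ?; rewrite x0V_lo; lra.
Qed.

Lemma x1V_lo t : 1/2 <= t -> t <= 5/8 -> x1V t = 2 * t - 1/2.
Proof. by move=> ? ?; rewrite x1V_ge// x0V_lo; lra. Qed.

Lemma x1V_mid t : 5/8 <= t -> t <= 3/4 -> x1V t = t + 1/8.
Proof. by move=> ? ?; rewrite x1V_ge ?x0V_mid; lra. Qed.

Lemma x1V_hi t : 3/4 <= t -> x1V t = (t + 1) / 2.
Proof. by move=> ?; rewrite x1V_ge ?x0V_hi; lra. Qed.

End Generators.

Ltac decide_ifs :=
  repeat first [(rewrite ifT; last lra) | (rewrite ifF; last lra)].

(** * A bounded harmonic function from a flow on a spanning tree *)

Section HarmonicFunction.
Variable R : realType.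
Implicit Types y : R.

(* The edges [y -- parent y] form a spanning tree of the Schreier graph, rooted
   at [1/2]; all other edges are loops or duplicates of tree edges. *)
Definition parent y : R :=
  if y < 1/2 then x0V y else if y < 3/4 then x1V y else x0 y.

(* The fraction of the flow through the edge above [parent y] that goes on to [y]. *)
Definition flow_ratio y : R :=
  if y < 1/2 then 0 else if y < 5/8 then 1/2 else
  if y < 3/4 then 1 else if y < 7/8 then 1/2 else 0.

(** The two sources sit at the children of 5/8 and cancel in the balance at 5/8, so the edges from
    1/2 down to 5/8 carry no flow. *)
Definition flow_source y : R := (y == 9/16)%:R - (y == 13/16)%:R.

(** Following [parent] is not structural recursion, so [n] serves as fuel; the base value is the
    right one at the root 1/2. *)
Fixpoint height_flow n y : R * R :=
  if n is m.+1 then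
    let v := height_flow m (parent y) in
    let f := flow_ratio y * v.2 + flow_source y in
    (v.1 + f, f)
  else (0, 0).

(** The default 0 makes [height] and [flow] vanish at points whose ancestors never include 1/2. *)
Definition reach_time y : nat := xget 0%N [set n | iter n parent y = 1/2].

Definition height y : R := (height_flow (reach_time y) y).1.
Definition flow y : R := (height_flow (reach_time y) y).2.

Lemma parent_half : parent (1/2) = 1/2.
Proof. by rewrite /parent ltxx ifT ?x1V_id; lra. Qed.

Lemma parent_threequarters : parent (3/4) = 1/2.
Proof. by rewrite /parent ltxx ifF ?x0_hi; lra. Qed.

Lemma parent_fiveeighths : parent (5/8) = 3/4.
Proof. by rewrite /parent ifF ?ifT ?x1V_mid; lra. Qed.

Lemma parent_nine : parent (9/16) = 5/8.
Proof. by rewrite /parent ifF ?ifT ?x1V_lo; lra. Qed.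

Lemma parent_thirteen : parent (13/16) = 5/8.
Proof. by rewrite /parent ifF ?ifF ?x0_hi; lra. Qed.

Lemma flow_source0 y : y != 9/16 -> y != 13/16 -> flow_source y = 0.
Proof. by rewrite /flow_source => /negbTE-> /negbTE->; rewrite subrr. Qed.

Lemma flow_source_nine : flow_source (9/16) = 1.
Proof.
by rewrite /flow_source eqxx (_ : _ == _ = false) ?subr0//; apply/eqP; lra.
Qed.

Lemma flow_source_thirteen : flow_source (13/16) = -1.
Proof.
by rewrite /flow_source eqxx (_ : _ == _ = false) ?sub0r//; apply/eqP; lra.
Qed.

Lemma height_flow_sourcefree n y :
  y != 9/16 -> y != 13/16 ->
  (forall m, height_flow m (parent y) = (0, 0)) -> height_flow n y = (0, 0).
Proof.
by move=> ? ? py; case: n => //= n; rewrite py flow_source0// mulr0 !addr0.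
Qed.

Lemma height_flow_half n : height_flow n (1/2) = (0, 0).
Proof.
elim: n => //= n IH; rewrite parent_half IH flow_source0 ?mulr0 ?addr0//;
  by apply/eqP; lra.
Qed.

Lemma height_flow_fiveeighths n : height_flow n (5/8) = (0, 0).
Proof.
apply: height_flow_sourcefree => [||m]; try by apply/eqP; lra.
rewrite parent_fiveeighths.
apply: height_flow_sourcefree => [||k]; try by apply/eqP; lra.
by rewrite parent_threequarters height_flow_half.
Qed.

(** Surplus fuel is spent at 1/2, which [parent] fixes and where the pair is [(0, 0)]. *)
Lemma height_flow_stable n m y :
  iter n parent y = 1/2 -> height_flow (n + m) y = height_flow n y.
Proof.
elim: n y => [|n IH] y; first by move=> /= ->; rewrite height_flow_half.
by rewrite iterSr => /IH; rewrite addSn /= => ->.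
Qed.

Lemma height_flow_reach n y : iter n parent y = 1/2 ->
  height_flow (reach_time y) y = height_flow n y.
Proof.
move=> yn; rewrite /reach_time; case: xgetP => [m _ ym|/(_ n)//].
by rewrite -(height_flow_stable n ym) addnC height_flow_stable.
Qed.

Lemma reachP y : (exists n, iter n parent y = 1/2) \/
  reach_time y = 0%N /\ forall n, iter n parent y <> 1/2.
Proof.
by rewrite /reach_time; case: xgetP => [m _ ym|]; [left; exists m|right].
Qed.

(** The fuel-free recursion holds on all of [R]: a point and its parent either both reach 1/2 or
    both fall under the default. *)
Lemma height_flow_parent y :
  height y = height (parent y) + flow y /\
  flow y = flow_ratio y * flow (parent y) + flow_source y.
Proof.
rewrite /height /flow; case: (reachP y) => [[n yn]|[y0 yn]].
  have pyn : iter n parent (parent y) = 1/2.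
    by rewrite -iterSr iterS yn parent_half.
  rewrite (height_flow_reach yn) (height_flow_reach pyn).
  by rewrite -(height_flow_stable 1 yn) addn1.
case: (reachP (parent y)) => [[n pyn]|[py0 pyn]].
  by case: (yn n.+1); rewrite iterSr.
(* Both sources reach 1/2 in three steps, so [y] is neither of them. *)
rewrite y0 py0 /= flow_source0 ?mulr0 ?addr0//; apply/eqP => yE.
  apply: (yn 3%N); rewrite yE /= parent_nine parent_fiveeighths.
  exact: parent_threequarters.
apply: (yn 3%N); rewrite yE /= parent_thirteen parent_fiveeighths.
exact: parent_threequarters.
Qed.

Lemma height_child x y : parent y = x -> height y = height x + flow y.
Proof. by move=> <-; have [] := height_flow_parent y. Qed.

Lemma flow_child x y : parent y = x ->
  flow y = flow_ratio y * flow x + flow_source y.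
Proof. by move=> <-; have [] := height_flow_parent y. Qed.

Lemma height_nine : height (9/16) = 1.
Proof.
have reach3 : iter 3 parent (9/16) = 1/2.
  by rewrite /= parent_nine parent_fiveeighths parent_threequarters.
rewrite /height (height_flow_reach reach3).
have -> n x : height_flow n.+1 x = ((height_flow n (parent x)).1 +
    (flow_ratio x * (height_flow n (parent x)).2 + flow_source x),
    flow_ratio x * (height_flow n (parent x)).2 + flow_source x) by [].
rewrite parent_nine height_flow_fiveeighths flow_source_nine /=.
by rewrite mulr0 !add0r.
Qed.

Lemma height_thirteen : height (13/16) = -1.
Proof.
have reach3 : iter 3 parent (13/16) = 1/2.
  by rewrite /= parent_thirteen parent_fiveeighths parent_threequarters.
rewrite /height (height_flow_reach reach3).
have -> n x : height_flow n.+1 x = ((height_flow n (parent x)).1 +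
    (flow_ratio x * (height_flow n (parent x)).2 + flow_source x),
    flow_ratio x * (height_flow n (parent x)).2 + flow_source x) by [].
rewrite parent_thirteen height_flow_fiveeighths flow_source_thirteen /=.
by rewrite mulr0 !add0r.
Qed.

Lemma flow_lo y : y < 1/2 -> flow y = 0.
Proof.
move=> y2; rewrite (flow_child erefl) /flow_ratio y2 mul0r flow_source0 ?addr0//.
  by apply/eqP; lra.
by apply/eqP; lra.
Qed.

Lemma flow_hi y : 7/8 <= y -> flow y = 0.
Proof.
move=> y2; rewrite (flow_child erefl) /flow_ratio !ifF; try lra.
by rewrite mul0r flow_source0 ?addr0//; apply/eqP; lra.
Qed.

Let hsum y : \sum_(g <- steps R) height (g y) =
  height (x0 y) + height (x0V y) + height (x1 y) + height (x1V y).
Proof. by rewrite /steps !big_cons big_nil addr0 !addrA. Qed.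

(** Every neighbour of [y] is [y], its parent or a child, and heights differ along a tree edge by
    the flow; the mean value property is thus conservation of flow. *)
Lemma height_harmonic y : height y = 1/4 * \sum_(g <- steps R) height (g y).
Proof.
rewrite hsum; case: (ltP y (1/2)) => y2.
  rewrite x1_id ?x1V_id; try lra.
  have x0y : x0 y = y / 2 by rewrite x0_lo; lra.
  have px0 : parent (x0 y) = y by rewrite /parent ifT ?x0K// x0y; lra.
  have x0V_p : parent y = x0V y by rewrite /parent y2.
  have f0 : flow (x0 y) = 0 by rewrite flow_lo ?x0y//; lra.
  rewrite (height_child px0) f0 (height_child x0V_p) flow_lo//; lra.
case: (ltP y (3/4)) => y34.
  have x0y : x0 y = y - 1/4 by rewrite x0_mid; lra.
  have px0 : parent (x0 y) = y by rewrite /parent ifT ?x0K// x0y; lra.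
  have x0Vy : x0V y = (y + 1) / 2 by rewrite x0V_hi.
  have px0V : parent (x0V y) = y by rewrite /parent !ifF ?x0VK// x0Vy; lra.
  have x1y : x1 y = y / 2 + 1/4 by rewrite x1_lo; lra.
  have px1 : parent (x1 y) = y by rewrite /parent ifF ?ifT ?x1K// x1y; lra.
  have x1V_p : parent y = x1V y by rewrite /parent ifF ?ifT//; lra.
  have f0 : flow (x0 y) = 0 by rewrite flow_lo ?x0y//; lra.
  (* The children [x0V y] and [x1 y] each take half of the flow; at [y = 5/8] they are 13/16 and
     9/16, and the sources cancel. *)
  have f0V : flow (x0V y) = 1/2 * flow y - (y == 5/8)%:R.
    rewrite (flow_child px0V) /flow_ratio x0Vy; decide_ifs.
    rewrite /flow_source (_ : _ == 9/16 = false); last by apply/eqP; lra.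
    rewrite (_ : (_ == 13/16) = (y == 5/8)) ?sub0r//.
    by apply/eqP/eqP => ?; lra.
  have f1 : flow (x1 y) = 1/2 * flow y + (y == 5/8)%:R.
    rewrite (flow_child px1) /flow_ratio x1y; decide_ifs.
    rewrite /flow_source (_ : _ == 13/16 = false); last by apply/eqP; lra.
    rewrite (_ : (_ == 9/16) = (y == 5/8)) ?subr0//.
    by apply/eqP/eqP => ?; lra.
  rewrite (height_child px0) (height_child px0V) (height_child px1).
  rewrite f0 f0V f1 (height_child x1V_p); lra.
case: (ltP y (7/8)) => y78.
  have x0_p : parent y = x0 y by rewrite /parent !ifF//; lra.
  have x0Vy : x0V y = (y + 1) / 2 by rewrite x0V_hi; lra.
  have px0V : parent (x0V y) = y by rewrite /parent !ifF ?x0VK// x0Vy; lra.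
  have x1y : x1 y = y - 1/8 by rewrite x1_mid; lra.
  have px1 : parent (x1 y) = y by rewrite /parent ifF ?ifT ?x1K// x1y; lra.
  (* Two generators lead to the same child, a dead end beyond 7/8, so all the flow passes to
     [x1 y]. *)
  have x1Vy : x1V y = x0V y by rewrite x1V_hi.
  have f0V : flow (x0V y) = 0 by rewrite flow_hi ?x0Vy//; lra.
  have f1 : flow (x1 y) = flow y.
    rewrite (flow_child px1) /flow_ratio x1y; decide_ifs.
    by rewrite mul1r flow_source0 ?addr0//; apply/eqP; lra.
  rewrite x1Vy (height_child px0V) (height_child px1) f0V f1.
  rewrite (height_child x0_p); lra.
have x0_p : parent y = x0 y by rewrite /parent !ifF//; lra.
have x1y : x1 y = x0 y by rewrite x1_hi// x0_hi//; lra.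
have x0Vy : x0V y = (y + 1) / 2 by rewrite x0V_hi; lra.
have px0V : parent (x0V y) = y by rewrite /parent !ifF ?x0VK// x0Vy; lra.
have x1Vy : x1V y = x0V y by rewrite x1V_hi//; lra.
have f0V : flow (x0V y) = 0 by rewrite flow_hi ?x0Vy//; lra.
rewrite x1Vy x1y (height_child px0V) f0V.
rewrite (height_child x0_p) flow_hi//; lra.
Qed.

(* The future height gain along any descending path is at most [flow_weight]
   times the current flow. *)
Definition flow_weight y : R :=
  if y < 1/2 then 0 else if y < 3/4 then 2 else if y < 7/8 then 3 else 0.

(** Away from the sources, a step to a child multiplies the flow by [flow_ratio] and adds the result
    to the height; this inequality keeps [|height| + flow_weight * |flow|] from growing. *)
Lemma flow_weight_parent y :
  (1 + flow_weight y) * flow_ratio y <= flow_weight (parent y).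
Proof.
have w0 x : 0 <= flow_weight x.
  by rewrite /flow_weight; repeat case: ifP => _; lra.
rewrite /flow_ratio; case: (ltP y (1/2)) => y2; first by rewrite mulr0.
case: (ltP y (5/8)) => y58.
  have := @x1V_lo R y; rewrite /parent; decide_ifs => ->; try lra.
  rewrite /flow_weight; decide_ifs; lra.
case: (ltP y (3/4)) => y34.
  have := @x1V_mid R y; rewrite /parent; decide_ifs => ->; try lra.
  rewrite /flow_weight; decide_ifs; lra.
case: (ltP y (7/8)) => y78; last by rewrite mulr0.
have := @x0_hi R y; rewrite /parent; decide_ifs => ->; try lra.
  rewrite /flow_weight; decide_ifs; lra.
Qed.

(** The left side starts afresh only at the sources, as 1 + 2 at 9/16 and 1 + 3 at 13/16; the latter
    gives the 4. *)
Lemma height_flow_bound n y :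
  `|(height_flow n y).1| + flow_weight y * `|(height_flow n y).2| <= 4.
Proof.
elim: n y => [|n IH] y /=; first by rewrite normr0 mulr0 addr0.
have [->|y9] := eqVneq y (9/16).
  rewrite parent_nine height_flow_fiveeighths flow_source_nine /=.
  rewrite mulr0 !add0r normr1 /flow_weight; decide_ifs; lra.
have [->|y13] := eqVneq y (13/16).
  rewrite parent_thirteen height_flow_fiveeighths flow_source_thirteen /=.
  rewrite mulr0 !add0r normrN1 /flow_weight; decide_ifs; lra.
have := IH (parent y); move: (height_flow n (parent y)) => [h f] /=.
rewrite flow_source0// addr0; apply: le_trans.
have ratio_ge0 : 0 <= flow_ratio y.
  by rewrite /flow_ratio; repeat case: ifP => _; lra.
have := ler_normD h (flow_ratio y * f).
have := ler_wpM2r (normr_ge0 f) (flow_weight_parent y).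
rewrite normrM (ger0_norm ratio_ge0); lra.
Qed.

Lemma height_bound y : `|height y| <= 4.
Proof.
apply: le_trans (height_flow_bound (reach_time y) y).
rewrite lerDl mulr_ge0// /flow_weight.
by repeat case: ifP => _; lra.
Qed.

End HarmonicFunction.

(** * Elements of F: action on dyadics and closure under composition *)

Section ThompsonClosure.
Variable R : realType.
Implicit Types (f g : R -> R) (s : seq R) (t u v : R).

Lemma dyadicD t u : dyadic t -> dyadic u -> dyadic (t + u).
Proof.
move=> [k [n ->]] [l [m ->]].
exists (k * 2 ^+ m + l * 2 ^+ n), (n + m)%N.
rewrite intrD !intrM !rmorphXn/= exprD; field.
by rewrite !expf_neq0.
Qed.

Lemma dyadicM t u : dyadic t -> dyadic u -> dyadic (t * u).
Proof.
move=> [k [n ->]] [l [m ->]]; exists (k * l), (n + m)%N.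
by rewrite intrM exprD; field; rewrite !expf_neq0.
Qed.

Lemma dyadicN t : dyadic t -> dyadic (- t).
Proof. by move=> [k [n ->]]; exists (- k), n; rewrite intrN mulNr. Qed.

Lemma dyadicB t u : dyadic t -> dyadic u -> dyadic (t - u).
Proof. by move=> dt du; apply: dyadicD => //; exact: dyadicN. Qed.

Lemma dyadic0 : dyadic (0 : R).
Proof. by exists 0, 0%N; rewrite mul0r. Qed.

Lemma dyadic_pow2 (k : int) : dyadic (2 ^ k : R).
Proof.
case: k => n; last by exists 1, n.+1; rewrite NegzE mul1r.
by exists (2 ^+ n), 0%N; rewrite expr0 divr1 rmorphXn.
Qed.

(** Supplies the left end [c] of an interval ending at [t] on which a map with breakpoints in [s] is
    affine. *)
Lemma last_break s t : 0 < t -> (forall b, b \in s -> dyadic b) ->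
  exists c, [/\ dyadic c, 0 <= c < t, c = 0 \/ c \in s &
    forall b, b \in s -> ~~ (c < b < t)].
Proof.
move=> t0; elim: s => [|a s IH] ds.
  by exists 0; split; rewrite ?lexx//; [exact: dyadic0|left].
have [b bs|c [dc ct cs cb]] := IH; first by apply: ds; rewrite inE bs orbT.
have [act|act] := boolP (c < a < t).
  exists a; split.
  - by apply: ds; rewrite inE eqxx.
  - lra.
  - by right; rewrite inE eqxx.
  - move=> b; rewrite inE => /orP[/eqP->|/cb]; first by rewrite ltxx.
    by apply: contraNN; lra.
exists c; split=> //; first by case: cs => [->|cs]; [left|right; rewrite inE cs orbT].
by move=> b; rewrite inE => /orP[/eqP->|/cb].
Qed.

Section Element.
Variable f : R -> R.
Hypothesis Ff : thompsonF f.

Lemma thompson_itv t : 0 <= t <= 1 -> 0 <= f t <= 1.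
Proof.
by case: Ff => -[fm _ _] _ _ _ t01; have := fm t; rewrite /= !in_itv /=; apply.
Qed.

Lemma thompson_surj t : 0 <= t <= 1 -> exists2 u, 0 <= u <= 1 & f u = t.
Proof.
case: Ff => -[_ _ fs] _ _ _ t01; have [|u] := fs t; first by rewrite /= in_itv.
by rewrite /= in_itv /= => u01 <-; exists u.
Qed.

Lemma thompson_lt u v : 0 <= u -> u < v -> v <= 1 -> f u < f v.
Proof.
by case: Ff => _ _ h _ u0 uv v1; apply: h => //; rewrite in_itv /=; lra.
Qed.

Lemma thompson_le u v : 0 <= u -> u <= v -> v <= 1 -> f u <= f v.
Proof.
by move=> u0; rewrite le_eqVlt => /predU1P[->//|uv] v1; rewrite ltW// thompson_lt.
Qed.

Lemma thompson0 : f 0 = 0.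
Proof.
have [u u01 fu] := @thompson_surj 0 ltac:(lra).
have := @thompson_le 0 u ltac:(lra) ltac:(lra) ltac:(lra).
by have := @thompson_itv 0 ltac:(lra); rewrite fu; lra.
Qed.

Lemma thompson1 : f 1 = 1.
Proof.
have [u u01 fu] := @thompson_surj 1 ltac:(lra).
have := @thompson_le u 1 ltac:(lra) ltac:(lra) ltac:(lra).
by have := @thompson_itv 1 ltac:(lra); rewrite fu; lra.
Qed.

Lemma thompson_affine s t : 0 < t <= 1 ->
  (forall b, b \in s -> dyadic b) -> pl_pow2 s f ->
  exists c (k : int), [/\ dyadic c, 0 <= c < t, c = 0 \/ c \in s &
    f t = f c + 2 ^ k * (t - c)].
Proof.
move=> t01 ds sf; have [c [dc ct cs cb]] := @last_break s t ltac:(lra) ds.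
have [||||k fk] := sf c t; try lra.
  by move=> b /cb.
by exists c, k; split => //; apply: fk; lra.
Qed.

(** Induction on the number of breakpoints below [t]: a nonzero [c] is itself counted below [t] but
    not below [c], and [f t] comes from [f c] by dyadic operations. *)
Lemma thompson_dyadic t : 0 <= t <= 1 -> dyadic t -> dyadic (f t).
Proof.
case: Ff => _ _ _ [s [ds sf]].
have [n] := ubnP (count (fun b => b < t) s).
elim: n t => // n IH t; rewrite ltnS => tn t01 dt.
have [->|tn0] := eqVneq t 0; first by rewrite thompson0; exact: dyadic0.
have [c [k [dc ct cs ->]]] := @thompson_affine s t ltac:(lra) ds sf.
apply: dyadicD; last by apply: dyadicM; [exact: dyadic_pow2|exact: dyadicB].
case: cs => [->|cs]; first by rewrite thompson0; exact: dyadic0.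
apply: IH => //; last lra.
apply: leq_trans tn.
elim: s cs {ds sf} => //= a s IH.
have sub : (count (fun b => b < c)%R s <= count (fun b => b < t)%R s)%N.
  by apply: sub_count => b /=; lra.
rewrite inE => /orP[/eqP<-|/IH{}IH].
  by rewrite ltxx (_ : c < t)%R ?add0n ?add1n ?ltnS//; lra.
rewrite -addnS leq_add//.
by case: (ltP a c) => // ac; rewrite (_ : a < t) //; lra.
Qed.

(** The affine piece ending at [t] is solved for [t]; the inverse of its slope is again a power of
    2. *)
Lemma thompson_dyadic_inv t : 0 <= t <= 1 -> dyadic (f t) -> dyadic t.
Proof.
case: Ff => _ _ _ [s [ds sf]] t01 dft.
have [->|tn0] := eqVneq t 0; first exact: dyadic0.
have [c [k [dc ct _ ft]]] := @thompson_affine s t ltac:(lra) ds sf.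
have -> : t = c + 2 ^ (- k) * (f t - f c).
  by rewrite ft addrAC subrr add0r mulrA -expfzDr// addNr expr0z; lra.
apply: dyadicD => //; apply: dyadicM; first exact: dyadic_pow2.
by apply: dyadicB => //; apply: thompson_dyadic => //; lra.
Qed.

(** Provides the breakpoints that the outer factor contributes to a composite. *)
Lemma thompson_break_preimage s : (forall b, b \in s -> dyadic b) ->
  exists s', (forall a, a \in s' -> dyadic a) /\
    forall b, b \in s -> 0 <= b <= 1 ->
      exists a, [/\ a \in s', 0 <= a <= 1 & f a = b].
Proof.
elim: s => [|c s IH] ds; first by exists [::].
have [b bs|s' [ds' ss']] := IH; first by apply: ds; rewrite inE bs orbT.
have [c01|c01] := boolP (0 <= c <= 1); last first.
  exists s'; split => // b; rewrite inE => /orP[/eqP->|/ss'//].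
  by rewrite (negbTE c01).
have [a a01 fa] := thompson_surj c01; exists (a :: s'); split.
  move=> b; rewrite inE => /orP[/eqP->|/ds'//].
  by apply: thompson_dyadic_inv; rewrite ?fa//; apply: ds; rewrite inE eqxx.
move=> b; rewrite inE => /orP[/eqP-> _|/ss'{}ss' /ss'[d [ds'd d01 fd]]].
  by exists a; rewrite inE eqxx.
by exists d; rewrite inE ds'd orbT.
Qed.
End Element.

(** Continuity follows from monotonicity and surjectivity, which leave no room for jumps. *)
Lemma thompsonFP f : 
  f 0 = 0 -> f 1 = 1 ->
  (forall t, 0 <= t <= 1 -> exists2 u, 0 <= u <= 1 & f u = t) ->
  (forall u v, 0 <= u -> u < v -> v <= 1 -> f u < f v) ->
  (exists s : seq R, (forall b, b \in s -> dyadic b) /\ pl_pow2 s f) ->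
  thompsonF f.
Proof.
move=> f0 f1 fs fm fb.
have fmi : {in `[0, 1] &, {homo f : u v / u < v}}.
  by move=> u v; rewrite !in_itv /= => u01 v01 uv; apply: fm; lra.
have f01 t : 0 <= t <= 1 -> 0 <= f t <= 1.
  have := @fm 0 t; have := @fm t 1; rewrite f0 f1.
  have [->|tn0] := eqVneq t 0; first by rewrite f0; lra.
  have [->|tn1] := eqVneq t 1; first by rewrite f1; lra.
  by move=> A B t01; have := A ltac:(lra) ltac:(lra) ltac:(lra);
    have := B ltac:(lra) ltac:(lra) ltac:(lra); lra.
have fbij : set_bij `[0, 1] `[0, 1] f.
  split.
  - by move=> t; rewrite /= !in_itv /= => /f01.
  - move=> u v; rewrite !inE /= !in_itv /= => u01 v01 fuv.
    by have [uv|uv|//] := ltgtP u v; have := fm _ _ _ uv; lra.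
  - by move=> t; rewrite /= in_itv /= => /fs[u u01 fu]; exists u; rewrite //= in_itv.
split=> //.
apply: segment_inc_surj_continuous.
  apply: le_mono_in => //.
by rewrite f0 f1; case: fbij.
Qed.

Lemma thompsonF_comp f g : thompsonF f -> thompsonF g -> thompsonF (g \o f).
Proof.
move=> Ff Fg; apply: thompsonFP => /=.
- by rewrite !thompson0.
- by rewrite !thompson1.
- move=> t /(thompson_surj Fg)[u /(thompson_surj Ff)[v v01 <-] <-].
  by exists v.
- move=> u v u0 uv v1.
  have [fu fv] := (@thompson_itv f Ff u, @thompson_itv f Ff v).
  by apply: thompson_lt => //; [lra|exact: thompson_lt|lra].
- have [_ _ _ [s [ds sf]]] := Ff; have [_ _ _ [r [dr rg]]] := Fg.
  have [r' [dr' rr']] := thompson_break_preimage Ff dr.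
  exists (s ++ r'); split=> [b|u v u0 uv v1 uvb].
    by rewrite mem_cat => /orP[/ds|/dr'].
  have [||||k fk] := sf u v => //.
    by move=> b bs; apply: uvb; rewrite mem_cat bs.
  have fuv := thompson_lt Ff u0 uv v1.
  have [fu fv] := (@thompson_itv f Ff u, @thompson_itv f Ff v).
  have [||||l gl] := rg (f u) (f v); try lra.
    (* A breakpoint of [g] between [f u] and [f v] would have a listed preimage between [u] and
       [v]. *)
    move=> b br; apply/negP => b_uv.
    have [a [ar' a01 fa]] := rr' _ br ltac:(lra).
    apply: (negP (uvb a _)); first by rewrite mem_cat ar' orbT.
    have := @thompson_le f Ff a u; have := @thompson_le f Ff v a; rewrite fa.
    by have [|] := ltP u a; have [|] := ltP a v; lra.
  exists (l + k) => t t_uv /=.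
  rewrite gl; last first.
    have := @thompson_le f Ff u t; have := @thompson_le f Ff t v; lra.
  by rewrite (fk t)// (addrC (f u)) addrK mulrA -expfzDr.
Qed.

End ThompsonClosure.

(** * The generators and their inverses as elements of F *)

Section ThompsonGenerators.
Variable R : realType.
Implicit Types (f g : R -> R) (s : seq R) (t u v : R).

Lemma dyadic_div2 (k : int) (n : nat) t : t = k%:~R / 2 ^+ n -> dyadic t.
Proof. by exists k, n. Qed.

Lemma thompsonF_x0 : thompsonF (@x0 R).
Proof.
apply: thompsonFP.
- by rewrite x0_lo; lra.
- by rewrite x0_hi; lra.
- move=> t t01; exists (x0V t); last exact: x0VK.
  rewrite /x0V; case: (leP t (1/4)) => ?; [lra|].
  by case: (leP t (1/2)) => ?; lra.
- move=> u v _ uv _; rewrite /x0.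
  case: (leP u (1/2)) => ?; case: (leP v (1/2)) => ?; try lra;
    by case: (leP v (3/4)) => ?; try lra; case: (leP u (3/4)) => ?; lra.
- exists [:: 1/2; 3/4]; split=> [b|u v u0 uv v1 uvb].
    rewrite !inE => /orP[|] /eqP->.
      by apply: (@dyadic_div2 1 1); lra.
    by apply: (@dyadic_div2 3 2); lra.
  have h2 := uvb (1/2) ltac:(by rewrite !inE eqxx).
  have h3 := uvb (3/4) ltac:(by rewrite !inE eqxx orbT).
  case: (leP v (1/2)) => v2.
    by exists (-1) => t tuv; rewrite !x0_lo -?[2 ^ _]/(2 ^- 1); lra.
  case: (leP v (3/4)) => v3.
    by exists 0 => t tuv; rewrite !x0_mid ?expr0z; lra.
  by exists 1 => t tuv; rewrite !x0_hi ?expr1z; lra.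
Qed.

Lemma thompsonF_x0V : thompsonF (@x0V R).
Proof.
apply: thompsonFP.
- by rewrite x0V_lo; lra.
- by rewrite x0V_hi; lra.
- move=> t t01; exists (x0 t); last exact: x0K.
  rewrite /x0; case: (leP t (1/2)) => ?; [lra|].
  by case: (leP t (3/4)) => ?; lra.
- move=> u v _ uv _; rewrite /x0V.
  case: (leP u (1/4)) => ?; case: (leP v (1/4)) => ?; try lra;
    by case: (leP v (1/2)) => ?; try lra; case: (leP u (1/2)) => ?; lra.
- exists [:: 1/4; 1/2]; split=> [b|u v u0 uv v1 uvb].
    rewrite !inE => /orP[|] /eqP->.
      by apply: (@dyadic_div2 1 2); lra.
    by apply: (@dyadic_div2 1 1); lra.
  have h2 := uvb (1/4) ltac:(by rewrite !inE eqxx).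
  have h3 := uvb (1/2) ltac:(by rewrite !inE eqxx orbT).
  case: (leP v (1/4)) => v2.
    by exists 1 => t tuv; rewrite !x0V_lo ?expr1z; lra.
  case: (leP v (1/2)) => v3.
    by exists 0 => t tuv; rewrite !x0V_mid ?expr0z; lra.
  by exists (-1) => t tuv; rewrite !x0V_hi -?[2 ^ _]/(2 ^- 1); lra.
Qed.

(** Both [x1] and [x1V] arise this way. Rescaling to [1/2, 1] keeps slopes and moves a breakpoint
    [b] to [(b + 1) / 2]; the junction 1/2 is added. *)
Lemma thompsonF_right_half f g :
  thompsonF f -> (forall t, t <= 1/2 -> g t = t) ->
  (forall t, 1/2 <= t -> g t = 1/2 + 1/2 * f (2 * t - 1)) -> thompsonF g.
Proof.
move=> Ff glo ghi; apply: thompsonFP.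
- by rewrite glo; lra.
- have E : 2 * 1 - 1 = 1 :> R by lra.
  by rewrite ghi ?E ?(thompson1 Ff); lra.
- move=> t t01; case: (leP t (1/2)) => t2; first by exists t => //; exact: glo.
  have [u u01 fu] := @thompson_surj R f Ff (2 * t - 1) ltac:(lra).
  have E : 2 * ((u + 1) / 2) - 1 = u by lra.
  by exists ((u + 1) / 2); rewrite ?ghi ?E ?fu; lra.
- move=> u v u0 uv v1; case: (leP v (1/2)) => v2; first by rewrite !glo; lra.
  rewrite (ghi v); last lra.
  case: (leP u (1/2)) => u2.
    rewrite glo//; have := @thompson_lt R f Ff 0 (2 * v - 1).
    by rewrite thompson0//; lra.
  by rewrite ghi; have := @thompson_lt R f Ff (2 * u - 1) (2 * v - 1); lra.
- have [_ _ _ [s [ds sf]]] := Ff.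
  exists (1/2 :: [seq (b + 1) / 2 | b <- s]); split=> [b|u v u0 uv v1 uvb].
    have d2 : dyadic (1/2 : R) by apply: (@dyadic_div2 1 1); lra.
    have d1 : dyadic (1 : R) by apply: (@dyadic_div2 1 0); lra.
    rewrite inE => /orP[/eqP->//|/mapP[c /ds dc ->]].
    by rewrite -[_^-1]mul1r; apply: dyadicM => //; exact: dyadicD.
  have h2 := uvb (1/2) ltac:(by rewrite !inE eqxx).
  case: (leP v (1/2)) => v2.
    by exists 0 => t tuv; rewrite !glo ?expr0z; lra.
  have [||||k fk] := sf (2 * u - 1) (2 * v - 1); try lra.
    move=> b bs; have : (b + 1) / 2 \in 1/2 :: [seq (b + 1) / 2 | b <- s].
      by rewrite inE (map_f (fun b => (b + 1) / 2) bs) orbT.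
    by move=> /uvb; lra.
  exists k => t tuv; rewrite (ghi t) ?(ghi u) ?(fk (2 * t - 1)); lra.
Qed.

Lemma thompsonF_steps g : g \in steps R -> thompsonF g.
Proof.
rewrite !inE => /or4P[] /eqP ->.
- exact: thompsonF_x0.
- exact: thompsonF_x0V.
- by apply: (thompsonF_right_half thompsonF_x0); [exact: x1_id|exact: x1_ge].
- by apply: (thompsonF_right_half thompsonF_x0V); [exact: x1V_id|exact: x1V_ge].
Qed.

Lemma Forbit_step y z g : g \in steps R -> Forbit y z -> Forbit y (g z).
Proof.
move=> /thompsonF_steps Fg [f Ff ->].
by exists (g \o f) => //; exact: thompsonF_comp.
Qed.

End ThompsonGenerators.

(** * Base 4 digits of a uniform point *)

Lemma sum_base4 (T : nmodType) (F : nat -> nat -> T) (m : nat) :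
  \sum_(k < (m * 4)%N) F (k %/ 4)%N (k %% 4)%N =
  \sum_(j < m) \sum_(d < 4) F j d.
Proof.
elim: m => [|m IH]; first by rewrite !big_ord0.
rewrite mulSn addnC big_ord_recr -{}IH.
rewrite (@big_split_ord _ _ _ (m * 4) 4) /=.
congr +%R; apply: eq_bigr => d _ /=.
by rewrite divnMDl// modnMDl divn_small// modn_small// addn0.
Qed.

Section Digits.
Variable R : realType.
Implicit Types x : R.

Definition digits4 (n : nat) x : nat := Num.truncn (4 ^+ n * x).

Lemma digits4_div4 n x : (digits4 n.+1 x %/ 4)%N = digits4 n x.
Proof.
rewrite /digits4; have [x0|x0] := ltP x 0.
  have N k : Num.truncn (4 ^+ k * x) = 0%N.
    apply/eqP; rewrite -leqn0 truncn_le_nat (@lt_trans _ _ 0)//.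
    by rewrite pmulr_rlt0// exprn_gt0.
  by rewrite !N.
apply/esym/truncn_def.
have /truncn_itv : 0 <= 4 ^+ n.+1 * x by rewrite mulr_ge0// exprn_ge0.
set m := Num.truncn _; rewrite exprS -mulrA.
have : (m %/ 4 * 4 <= m)%N by exact: leq_trunc_div.
have : (m.+1 <= (m %/ 4).+1 * 4)%N by rewrite ltn_ceil.
rewrite -!(ler_nat R) !natrM; lra.
Qed.

(** Sublevel sets are half lines, level sets come from them by difference, and [Q] needs only
    countably many level sets. *)
Lemma measurable_digits4 n (Q : set nat) :
  measurable [set x : measurableTypeR R | Q (digits4 n x)].
Proof.
have mL k : measurable [set x : measurableTypeR R | (digits4 n x <= k)%N].
  rewrite (_ : [set _ | _] = `]-oo, (k.+1%:R / 4 ^+ n)[%classic) //.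
  apply/seteqP; split => x /=; rewrite in_itv /= truncn_le_nat;
    by rewrite ltr_pdivlMr ?exprn_gt0// mulrC.
rewrite (_ : [set _ | _] =
    \bigcup_(k in Q) [set x | digits4 n x = k]); last first.
  by apply/seteqP; split => [x Qx|x [k Qk /= ->//]]; exists (digits4 n x).
apply: bigcup_measurable => -[|k] _.
  rewrite (_ : [set _ | _] = [set x | (digits4 n x <= 0)%N])//.
  by apply/seteqP; split => x /=; rewrite leqn0 => /eqP.
rewrite (_ : [set _ | _] =
  [set x | (digits4 n x <= k.+1)%N] `\` [set x | (digits4 n x <= k)%N]).
  exact: measurableD.
apply/seteqP; split => x /=; first by move=> ->; rewrite ltnn.
by move=> [+ /negP]; rewrite -ltnNge => A B; apply/eqP; rewrite eqn_leq A.
Qed.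

Let U : probability (measurableTypeR R) R := uniform_prob (@ltr01 R).

Lemma uniform_itv a b : 0 <= a -> a <= b -> b <= 1 ->
  U `[a, b[%classic = (b - a)%:E.
Proof.
move=> a0 ab b1; rewrite /U/= /uniform_prob.
rewrite (eq_integral (cst 1%E)); last first.
  move=> x; rewrite inE /= in_itv /= /uniform_pdf => x_ab.
  by rewrite ifT ?subr0 ?invr1//; lra.
rewrite integral_cst//= mul1e lebesgue_measure_itv /= lte_fin.
by case: ltgtP ab => // -> _; rewrite subrr.
Qed.

(** The right end is left out because [digits4 n 1] is [4 ^ n], one past the largest prefix. *)
Lemma uniform_unit_itv (A : set (measurableTypeR R)) : measurable A ->
  U A = U (A `&` `[0, 1[%classic).
Proof.
move=> mA; rewrite [LHS](measureDI _ mA (measurable_itv `[0, 1[)).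
rewrite [X in (X + _)%E](_ : _ = 0%E) ?add0e//.
apply/eqP; rewrite eq_le measure_ge0 andbT.
have <- : U (~` `[0, 1[%classic) = 0%E.
  rewrite probability_setC// uniform_itv ?subr0 ?lexx ?ler01//.
  by rewrite subee.
by apply: le_measure; rewrite ?inE; [exact: measurableD|exact: measurableC|move=> x []].
Qed.

(** Within [0, 1), each prefix [k] below [4 ^ n] is taken exactly on an interval of length
    [4 ^- n]. *)
Lemma uniform_digits4 n (Q : pred nat) :
  U [set x | Q (digits4 n x)] = ((\sum_(k < 4 ^ n) (Q k)%:R) / 4 ^+ n)%:E.
Proof.
rewrite uniform_unit_itv; last exact: (measurable_digits4 n (fun k => Q k)).
pose I k := if Q k then `[(k%:R / 4 ^+ n), (k.+1%:R / 4 ^+ n)[%classic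
            else set0 : set (measurableTypeR R).
have E0 : 0 < 4 ^+ n :> R by rewrite exprn_gt0.
have II k x : I k x -> digits4 n x = k /\ Q k.
  rewrite /I; case: ifP => [Qk /=|_ []//]; rewrite in_itv /=.
  rewrite ler_pdivrMr// ltr_pdivlMr// mulrC => kx; split => //.
  exact: truncn_def.
rewrite (_ : _ `&` _ = \big[setU/set0]_(k < 4 ^ n) I k); last first.
  rewrite -bigcup_mkord; apply/seteqP; split => x /=.
    rewrite in_itv /= => -[Qx /andP[x0 x1]].
    have /truncn_itv /andP[dl dr] : 0 <= 4 ^+ n * x by rewrite mulr_ge0// ltW.
    exists (digits4 n x) => /=.
      rewrite -(ltr_nat R) (le_lt_trans dl)// natrX.
      by rewrite -[ltRHS]mulr1 ltr_pM2l.
    by rewrite /I Qx /= in_itv /= ler_pdivrMr// ltr_pdivlMr// mulrC dl dr.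
  move=> [k /= kn Ix]; have [dx Qk] := II _ _ Ix.
  rewrite dx; split => //; move: Ix; rewrite /I Qk /= !in_itv /=.
  move=> /andP[xl xr]; apply/andP; split.
    by apply: le_trans xl; rewrite divr_ge0// ltW.
  by apply: (lt_le_trans xr); rewrite ler_pdivrMr// mul1r -natrX ler_nat.
transitivity (\sum_(k < 4 ^ n) U (I k))%E.
  apply: measure_bigsetU; first by move=> k; rewrite /I; case: ifP.
  apply/trivIsetP => i j _ _; apply: contraNeq => /set0P[x [/II[<- _] /II[<- _]]].
  by [].
rewrite mulr_suml -sumEFin; apply: eq_bigr => -[k kn] _ /=.
rewrite /I; case: ifP => _; last by rewrite measure0 mul0r.
rewrite uniform_itv; first by rewrite -mulrBl -natrB// subSnn.
- by rewrite divr_ge0// ltW.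
- by rewrite ler_pM2r ?invr_gt0// ler_nat.
- by rewrite ler_pdivrMr// mul1r -natrX ler_nat.
Qed.

End Digits.

(** * The walk driven by base 4 digits and the persistence of positivity *)

Section RandomWalk.
Variables (R : realType) (V : pointedType) (step : nat -> V -> V) (o : V).
Local Notation trajectory := (g_sigma_algebraType (@coordinate_events V)).
Implicit Types D : nat -> pred V.

(** The [n] base 4 digits of [k], most significant first, choose the successive moves. *)
Fixpoint walk n k : V :=
  if n is m.+1 then step (k %% 4)%N (walk m (k %/ 4)%N) else o.

Definition walk_trajectory (x : measurableTypeR R) : trajectory :=
  fun n => walk n (digits4 n x).

Lemma measurable_coordinate n (B : set V) :
  measurable [set w : trajectory | B (w n)].
Proof. by apply: sub_sigma_algebra; exists n, B. Qed.

Lemma measurable_walk_trajectory : measurable_fun setT walk_trajectory.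
Proof.
apply: (@measurability _ _ _ trajectory setT walk_trajectory
  (@coordinate_events V)); first by [].
move=> _ [A [n [B ->]] <-].
rewrite setTI; exact: (measurable_digits4 n [set k | B (walk n k)]).
Qed.

HB.instance Definition _ := isMeasurableFun.Build _ _ _ _ walk_trajectory
  measurable_walk_trajectory.

Definition walk_law : probability trajectory R :=
  distribution (uniform_prob (@ltr01 R)) walk_trajectory.

(** Conditions on the path up to time [n] become a test on the prefix [k], so that probabilities
    turn into finite counts. *)
Fixpoint follows D n k : bool :=
  (if n is m.+1 then follows D m (k %/ 4)%N else true) && D n (walk n k).

Lemma followsP D n x :
  reflect (forall i, (i <= n)%N -> D i (walk_trajectory x i))
          (follows D n (digits4 n x)).
Proof.
elim: n => [|n IH] /=.
  apply: (iffP idP) => [Do i|/(_ 0%N)]; last exact.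
  by rewrite leqn0 => /eqP ->.
rewrite [in X in follows _ _ X]digits4_div4.
apply: (iffP andP) => [[/IH Dn DSn] i|Di].
  by rewrite leq_eqVlt => /predU1P[->//|/Dn].
by split; [apply/IH => i i_n; apply/Di/leqW|exact: (Di n.+1)].
Qed.

Lemma follows_last D n k :
  (forall i y, (i < n)%N -> D i y) -> follows D n k = D n (walk n k).
Proof.
elim: n k => // n IH k Dn.
rewrite [LHS]/= IH => [|i y i_n]; last by apply: Dn; exact: leqW.
by rewrite Dn.
Qed.

Lemma walk_law_follows D n :
  walk_law [set w | forall i, (i <= n)%N -> D i (w i)] =
  ((\sum_(k < 4 ^ n) (follows D n k)%:R) / 4 ^+ n)%:E.
Proof.
rewrite -uniform_digits4 /walk_law /= /distribution /pushforward /=.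
by congr (uniform_prob _ _); apply/seteqP; split => x /= /followsP.
Qed.

(** One-step Markov property in counting form: [k = 4 j + d] separates the last move from the
    earlier ones. *)
Lemma sum_follows D (f : V -> R) n :
  \sum_(k < 4 ^ n.+1) (follows D n.+1 k)%:R * f (walk n.+1 k) =
  \sum_(j < 4 ^ n) (follows D n j)%:R *
    \sum_(d < 4) (D n.+1 (step d (walk n j)))%:R * f (step d (walk n j)).
Proof.
pose F j d := (follows D n j && D n.+1 (step d (walk n j)))%:R *
  f (step d (walk n j)).
rewrite expnS mulnC (sum_base4 F).
apply: eq_bigr => j _; rewrite mulr_sumr; apply: eq_bigr => d _.
by rewrite mulrA -natrM mulnb.
Qed.

Lemma walk_trajectory_law :
  trajectory_law (fun y z => (count (fun d => step d y == z) (iota 0 4))%:R / 4)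
    o walk_law.
Proof.
move=> n v; pose D i y := y == v i.
rewrite (_ : [set _ | _] = [set w : trajectory | forall i, (i <= n)%N -> D i (w i)]);
  last first.
  by apply/seteqP; split => w /= wv i /wv /eqP.
rewrite walk_law_follows; congr EFin.
elim: n => [|n IH].
  by rewrite big_ord_recl !big_ord0 addr0 divr1 mulr1 /= /D eq_sym.
(* A prefix that has followed [v] ends at [v n], so its admissible extensions are the moves from
   [v n] to [v n.+1]. *)
have -> : \sum_(k < 4 ^ n.+1) (follows D n.+1 k)%:R =
    (\sum_(j < 4 ^ n) (follows D n j)%:R) *
    (count (fun d => step d (v n) == v n.+1) (iota 0 4))%:R :> R.
  under eq_bigr do rewrite -[_%:R]mulr1.
  rewrite (sum_follows D (fun=> 1)) mulr_suml; apply: eq_bigr => j _.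
  case E : (follows D n j); last by rewrite !mul0r.
  congr (_ * _).
  have -> : walk n j = v n.
    by case: n {IH} j E => [|n] j /=; [|case/andP => _] => /eqP.
  by rewrite /= !big_ord_recl big_ord0 /= !mulr1 addr0 -!natrD addn0.
by rewrite big_ord_recr /= mulrA -{}IH exprSr invfM mulrACA.
Qed.

Lemma measurable_eventually (B : set V) :
  measurable [set w : trajectory | exists m, forall n, (m <= n)%N -> B (w n)].
Proof.
rewrite (_ : [set _ | _] =
  \bigcup_m \bigcap_(n in [set n | (m <= n)%N]) [set w : trajectory | B (w n)]).
  apply: bigcup_measurable => m _; apply: bigcap_measurable.
    by exists m => /=.
  by move=> n _; exact: measurable_coordinate.
by apply/seteqP; split => w /= [m]; [exists m|move=> _; exists m].
Qed.

Lemma walk_law_eventually_gt0 (h : V -> R) (M : R) (N k : nat) :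
  (forall y, h y <= M) -> (forall y, h y = 1/4 * \sum_(d < 4) h (step d y)) ->
  (k < 4 ^ N)%N -> 0 < h (walk N k) ->
  (0 < walk_law [set w | exists m, forall n, (m <= n)%N -> (0 < h (w n))%R])%E.
Proof.
move=> hM h_harm kN hk.
have M0 : 0 < M by exact: lt_le_trans hk (hM _).
pose D i y := (i < N)%N || (0 < h y).
(* For [N <= n], [S n] is the expectation of [h] at time [n] restricted to paths on which [h] has
   been positive since time [N]. *)
pose S n := (\sum_(k < 4 ^ n) (follows D n k)%:R * h (walk n k)) / 4 ^+ n.
have S_N : 0 < S N.
  have DN j : follows D N j = (0 < h (walk N j)).
    by rewrite follows_last /D ?ltnn// => i y ->.
  rewrite divr_gt0 ?exprn_gt0// (bigD1 (Ordinal kN))//= DN hk mul1r.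
  rewrite ltr_pwDl// sumr_ge0// => j _; rewrite DN.
  by case: ltP => // hj; rewrite ?mul1r ?mul0r// ltW.
(* By harmonicity another move preserves the sum, and the restriction drops only nonpositive
   terms. *)
have S_le n : (N <= n)%N -> S n <= S n.+1.
  move=> Nn; rewrite /S sum_follows exprS invfM mulrA ler_wpM2r//.
  rewrite ler_pdivlMr// mulr_suml; apply: ler_sum => j _.
  rewrite -mulrA ler_wpM2l// {1}h_harm.
  have -> (s : R) : 1/4 * s * 4 = s by field.
  apply: ler_sum => d _.
  have -> : D n.+1 (step d (walk n j)) = (0 < h (step d (walk n j))).
    by rewrite /D ltnNge (leqW Nn).
  by case: ltP => // ?; rewrite ?mul1r ?mul0r.
have S_ge n : S N <= S (N + n)%N.
  elim: n => [|n IH]; first by rewrite addn0.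
  by apply: (le_trans IH); rewrite addnS S_le// leq_addr.
pose F n := [set w : trajectory | forall i, (i <= n)%N -> D i (w i)].
have mF n : measurable (F n).
  rewrite (_ : F n = \bigcap_(i in [set i | (i <= n)%N])
     [set w : trajectory | D i (w i)])//.
  apply: bigcap_measurable; first by exists 0%N.
  by move=> i _; exact: (measurable_coordinate i (fun y => D i y)).
have FS : {homo F : n m / (n <= m)%N >-> (m <= n)%O}.
  move=> n m nm; apply/subsetPset => w Fw i i_n; apply: Fw.
  exact: leq_trans nm.
(* The bound [h <= M] turns [S N] into a lower bound on probability; time [N + n] is used because
   [S] is monotone only from [N] on. *)
have F_ge n : ((S N / M)%:E <= walk_law (F n))%E.
  apply: (@le_trans _ _ (walk_law (F (N + n)%N))); last first.
    by apply: le_measure; rewrite ?inE//; apply/subsetPset/FS/leq_addl.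
  rewrite walk_law_follows lee_fin ler_pdivrMr//.
  apply: (le_trans (S_ge n)); rewrite mulrAC /S ler_wpM2r//.
  by rewrite mulr_suml; apply: ler_sum => j _; rewrite ler_wpM2l.
have mFoo : measurable (\bigcap_n F n) by exact: bigcapT_measurable.
apply: (@lt_le_trans _ _ (walk_law (\bigcap_n F n))); last first.
  apply: le_measure; rewrite ?inE//.
    exact: (measurable_eventually (fun y => 0 < h y)).
  move=> w Fw; exists N => n Nn.
  by have := Fw n I n (leqnn n); rewrite /D ltnNge Nn.
apply: (@lt_le_trans _ _ (S N / M)%:E); first by rewrite lte_fin divr_gt0.
(* Continuity from above carries the uniform bound to the event that positivity never fails after
   [N]. *)
have Fcvg : walk_law (F n) @[n --> \oo] --> walk_law (\bigcap_n F n).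
  apply: nonincreasing_cvg_mu => //.
  by rewrite (le_lt_trans (probability_le1 _ _))// ltry.
rewrite -(cvg_lim _ Fcvg)//; apply: lime_ge.
  by apply/cvg_ex; exists (walk_law (\bigcap_n F n)).
exact: nearW.
Qed.

End RandomWalk.

(** * The simple random walk on the Schreier graph *)

Section SimpleRandomWalkH.
Variable R : realType.

Lemma vertex_step_subproof d (y : vertex R) :
  nth id (steps R) d (val y) \in Forbit (1/2).
Proof.
rewrite inE; have := set_valP y.
(* Indices beyond the list select [id], which keeps the step total. *)
case: (ltnP d (size (steps R))) => [ds|ds]; last by rewrite nth_default.
by apply: Forbit_step; exact: mem_nth.
Qed.

Definition vertex_step d (y : vertex R) : vertex R :=
  exist (fun z => z \in Forbit (1/2)) _ (vertex_step_subproof d y).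

Lemma srw_H_step :
  @srw_H R = fun y z => (count (fun d => vertex_step d y == z) (iota 0 4))%:R / 4.
Proof. by apply/funext => y; apply/funext => z. Qed.

Lemma height_vertex_harmonic (y : vertex R) :
  height (val y) = 1/4 * \sum_(d < 4) height (val (vertex_step d y)).
Proof.
rewrite [LHS]height_harmonic; congr (_ * _).
by rewrite !big_ord_recl big_ord0 /steps !big_cons big_nil.
Qed.

Let law := walk_law R vertex_step (@half_vertex R).

Let x1_x0V_half : x1 (x0V (1/2)) = 5/8 :> R.
Proof. by rewrite x0V_hi ?x1_mid; lra. Qed.

(** In base 4, 26 is 122: the moves are [x0V], [x1], [x1], through 3/4 and 5/8. *)
Lemma walk_nine : val (walk vertex_step (@half_vertex R) 3 26) = 9/16.
Proof.
by rewrite [LHS](_ : _ = x1 (x1 (x0V (1/2))))// x1_x0V_half x1_lo; lra.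
Qed.

(** In base 4, 25 is 121: only the last move changes, to [x0V]. *)
Lemma walk_thirteen : val (walk vertex_step (@half_vertex R) 3 25) = 13/16.
Proof.
by rewrite [LHS](_ : _ = x0V (x1 (x0V (1/2))))// x1_x0V_half x0V_hi; lra.
Qed.

(** The sign treats the height and its opposite at once; 64 is [4 ^ 3], the number of three-move
    paths. *)
Lemma height_eventually_gt0 (sgn : R) k : (k < 64)%N ->
  `|sgn| = 1 -> 0 < sgn * height (val (walk vertex_step (@half_vertex R) 3 k)) ->
  (0 < law [set w | exists m, forall n,
    (m <= n)%N -> (0 < sgn * height (val (w n)))%R])%E.
Proof.
move=> k64 sgn1 hk; pose h (y : vertex R) := sgn * height (val y).
have h4 y : h y <= 4.
  apply: le_trans (ler_norm _) _; rewrite normrM sgn1 (mul1r `|_|).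
  exact: height_bound.
have h_harm y : h y = 1/4 * \sum_(d < 4) h (vertex_step d y).
  by rewrite /h height_vertex_harmonic mulrCA mulr_sumr.
exact: (@walk_law_eventually_gt0 _ _ _ _ h 4 3 k h4 h_harm k64 hk).
Qed.

Lemma srw_H_poisson_boundary_nontrivial :
  poisson_boundary_nontrivial (@srw_H R) (@half_vertex R).
Proof.
exists law; first by rewrite srw_H_step; exact: walk_trajectory_law.
pose A (sgn : R) := [set w : nat -> vertex R | exists m, forall n,
  (m <= n)%N -> 0 < sgn * height (val (w n))].
have mA sgn : measurable
    (A sgn : set (g_sigma_algebraType (@coordinate_events (vertex R)))).
  exact: (measurable_eventually (fun y : vertex R => 0 < sgn * height (val y))).
have A1 : (0 < law (A 1%R))%E.
  apply: (@height_eventually_gt0 _ 26) => //; first exact: normr1.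
  by rewrite walk_nine height_nine mulr1.
have AN1 : (0 < law (A (-1)%R))%E.
  apply: (@height_eventually_gt0 _ 25) => //; first exact: normrN1.
  by rewrite walk_thirteen height_thirteen mulrNN mulr1.
exists (A 1); split; first exact: mA.
  (* The threshold [m.+1] serves both inclusions; in the first it rules out time 0, which the shift
     forgets. *)
  apply/seteqP; split => w [m wm]; exists m.+1 => n; last first.
    by move=> mn; apply: wm; rewrite (leq_trans (leqnSn m))// (leq_trans mn).
  by case: n => // n mn; exact: wm.
rewrite A1 /=; apply: (@le_lt_trans _ _ (law (~` A (-1)))).
  apply: (@le_measure _ _ _ law); rewrite ?inE; [exact: mA|apply: measurableC; exact: mA|].
  move=> w [m wm] [l wl]; have := wm (maxn m l) (leq_maxl m l).
  have := wl (maxn m l) (leq_maxr m l).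
  by rewrite mulN1r (mul1r (height _)) oppr_gt0; lra.
rewrite probability_setC; last exact: mA.
by rewrite lteBlDr ?fin_num_measure// lteDl//.
Qed.

End SimpleRandomWalkH.

Theorem mainTheorem1 (R : realType) :
  poisson_boundary_nontrivial (@srw_H R) (@half_vertex R) /\
  exists h : R -> R, [/\ bounded_H h, harmonic_H h & nonconstant_H h].
Proof.
split; first exact: srw_H_poisson_boundary_nontrivial.
exists (@height R); split.
- by exists 4 => y _; exact: height_bound.
- by move=> y _; exact: height_harmonic.
- exists (9/16), (13/16); split; last by rewrite height_nine height_thirteen; lra.
    (* A point visited by the walk lies in the orbit of 1/2. *)
    rewrite -walk_nine; exact: set_valP.
  rewrite -walk_thirteen; exact: set_valP.
Qed.
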